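(* Let $\sigma_1<\sigma_2<\cdots<\sigma_K$ be real numbers, let $f:\mathbb{R}\to\mathbb{R}$ be continuous, strictly convex, with a minimum at $0$, and let $c_k(s)=f(s-\sigma_k)$ for $k\in\mathcal{K}=\{1,\dots,K\}$. Let $\mu>0$, $Q_k>0$ ($k\in\mathcal K$), $Q=\sum_{k\in\mathcal K}Q_k$, $T=Q/\mu$, and let $\hat{\mathcal S}=[s_0,s_0+T]$ be the (given) equilibrium rush period. Let $\mathbf{x}^*$ be the equilibrium flow pattern, i.e. the solution of $$\min_{\mathbf{x}\ge 0}\ \sum_{k\in\mathcal K}\int_{\hat{\mathcal S}}c_k(s)x_k(s)\,\mathrm{d}s\quad\text{subject to}\quad \sum_{k\in\mathcal K}x_k(s)=\mu\ \ \forall s\in\hat{\mathcal S},\qquad \int_{\hat{\mathcal S}}x_k(s)\,\mathrm{d}s=Q_k\ \ \forall k\in\mathcal K .$$ Define $s_k=s_0+\sum_{k'\le k}Q_{k'}/\mu$ for $k=1,\dots,K$. Then $\mathbf{x}^*$ has the sorting property: for every $k\in\mathcal K$ all users in group $k$ depart from the bottleneck in the time interval $[s_{k-1},s_k]$, of length $Q_k/\mu$ (i.e. $x^*_k(s)=0$ for almost every $s\in\hat{\mathcal S}\setminus[s_{k-1},s_k]$), and $$s_0<s_1<s_2<\cdots<s_{K-1}<s_K=s_0+T .$$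
   Context: The departure-time choice equilibrium at a single bottleneck of capacity $\mu$ with $K$ user groups of masses $Q_k$, schedule delay costs $c_k(s)$ and preferred departure times $\sigma_k$ is represented by a linear program; when the rush period is a single interval $\hat{\mathcal S}=[s_0,s_0+T]$, the program restricted to that period is the one displayed in the claim. The unknowns $x_k$ are nonnegative measurable functions on $\hat{\mathcal S}$ (departure flow rates of group $k$); constraints on $s$ are understood for almost every $s$. *)

(* Defs.v *)
From HB Require Import structures.
From mathcomp Require Import all_boot all_order all_algebra.
From mathcomp Require Import all_classical all_reals all_analysis.
Import Order.TTheory GRing.Theory Num.Theory.
Import numFieldNormedType.Exports.

Set Implicit Arguments.
Unset Strict Implicit.
Unset Printing Implicit Defensive.

Local Open Scope classical_set_scope.
Local Open Scope ring_scope.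

(* Groups are indexed by 'I_K, so i : 'I_K stands for the group i + 1 of the
   usual numbering 1, ..., K. *)

Definition strictly_convex (R : realType) (f : R -> R) : Prop :=
  forall (x y t : R), x != y -> 0 < t < 1 ->
    f (t * x + (1 - t) * y) < t * f x + (1 - t) * f y.

Definition schedule_cost (R : realType) (K : nat) (f : R -> R)
    (sigma : 'I_K -> R) (k : 'I_K) (s : R) : R :=
  f (s - sigma k).

Definition rush_length (R : realType) (K : nat) (mu : R) (Q : 'I_K -> R) : R :=
  (\sum_(k < K) Q k) / mu.

Definition rush_period (R : realType) (K : nat) (mu : R) (Q : 'I_K -> R)
    (s0 : R) : set R :=
  `[s0, s0 + rush_length mu Q].

(* Only the values of the flows x k on S matter. *)
Definition feasible_flow (R : realType) (K : nat) (S : set R) (mu : R)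
    (Q : 'I_K -> R) (x : 'I_K -> R -> R) : Prop :=
  [/\ forall k : 'I_K, measurable_fun S (x k),
      forall k : 'I_K, {ae lebesgue_measure, forall s : R, S s -> 0 <= x k s},
      {ae lebesgue_measure, forall s : R, S s -> \sum_(k < K) x k s = mu}
    & forall k : 'I_K,
        (\int[lebesgue_measure]_(s in S) (x k s)%:E)%E = (Q k)%:E].

(* The sum is taken in the extended reals; when S is a bounded interval, each
   c k is continuous and x is feasible, every term is finite. *)
Definition total_schedule_cost (R : realType) (K : nat) (S : set R)
    (c x : 'I_K -> R -> R) : \bar R :=
  (\sum_(k < K) \int[lebesgue_measure]_(s in S) (c k s * x k s)%:E)%E.

Definition equilibrium_flow (R : realType) (K : nat) (S : set R) (mu : R)
    (Q : 'I_K -> R) (c x : 'I_K -> R -> R) : Prop :=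
  feasible_flow S mu Q x /\
  forall y : 'I_K -> R -> R, feasible_flow S mu Q y ->
    (total_schedule_cost S c x <= total_schedule_cost S c y)%E.

(* For 0 <= j <= K, the time s_j = s_0 + (Q_1 + ... + Q_j) / mu; in the 'I_K
   numbering the interval of group i is [s_i, s_(i+1)]. *)
Definition sorting_time (R : realType) (K : nat) (mu : R) (Q : 'I_K -> R)
    (s0 : R) (j : nat) : R :=
  s0 + (\sum_(k < K | (k < j)%N) Q k / mu).

(* Main.v *)
(** Linear programming duality. Strict convexity makes c_(k+1) - c_k strictly
    decreasing, so the gap c_(k+1)(s) - c_k(s) - (c_(k+1)(t) - c_k(t)), with
    t = s_(k+1), changes sign exactly at the switching time t. Summing positive
    and negative parts of these gaps writes c_k(s) as p_k + m(s) + w_k(s), where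
    w_k >= 0 vanishes on the interval of group k and is positive elsewhere in
    the rush period. The terms p_k and m contribute the same amount to the cost
    of every feasible flow, and the sorted flow makes the w-part vanish; hence
    an optimal x satisfies w_k x_k = 0 almost everywhere. *)

Require Import Defs.
From HB Require Import structures.
From mathcomp Require Import all_boot all_order all_algebra.
From mathcomp Require Import all_classical all_reals all_analysis.
From mathcomp Require Import measurable_realfun ring lra.
Import Order.TTheory GRing.Theory Num.Theory.
Import numFieldNormedType.Exports.

Set Implicit Arguments.
Unset Strict Implicit.
Unset Printing Implicit Defensive.

Local Open Scope classical_set_scope.
Local Open Scope ring_scope.

(** * Convexity and integrability preliminaries *)

(** The points [t - b] and [s - a] both lie strictly between [s - b] and [t - a], with complementary
    weights [l] and [1 - l]; adding the two strict convexity inequalities gives the claim. *)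
Lemma strictly_convex_increment (R : realType) (f : R -> R) (a b s t : R) :
  strictly_convex f -> a < b -> s < t ->
  f (t - b) - f (t - a) < f (s - b) - f (s - a).
Proof.
move=> fconv ab st.
set d := t - s + (b - a).
have d0 : 0 < d by rewrite /d; lra.
set l := (b - a) / d.
have l01 : 0 < l < 1.
  by rewrite /l divr_gt0 ?subr_gt0//= ltr_pdivrMr// mul1r /d; lra.
have ld : l * d = b - a by rewrite /l mulfVK ?gt_eqF.
have ne : s - b != t - a by rewrite lt_eqF//; lra.
have ne' : t - a != s - b by rewrite eq_sym.
have := fconv _ _ _ ne l01; have := fconv _ _ _ ne' l01.
have -> : l * (s - b) + (1 - l) * (t - a) = t - b.
  by transitivity (t - a - l * d); [rewrite /d; ring | rewrite ld; ring].
have -> : l * (t - a) + (1 - l) * (s - b) = s - a.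
  by transitivity (s - b + l * d); [rewrite /d; ring | rewrite ld; ring].
lra.
Qed.

Lemma integrable_continuousM (R : realType) (a b : R) (g x : R -> R) :
  continuous g ->
  lebesgue_measure.-integrable `[a, b] (EFin \o x) ->
  lebesgue_measure.-integrable `[a, b] (fun s => (g s * x s)%:E).
Proof.
move=> gcont xint.
have -> : (fun s => (g s * x s)%:E) = ((EFin \o g) \* (EFin \o x))%E.
  by apply/funext => s; rewrite /= EFinM.
apply: integrableMr => //.
- by apply: measurable_funTS; exact: continuous_measurable_fun.
- have gab : {within `[a, b], continuous g} by exact: continuous_subspaceT.
  have /compact_bounded := continuous_compact gab (@segment_compact _ a b).
  move=> [M [Mr hM]]; exists M; split => // M' /hM h s abs.
  by apply: h; exists s.
Qed.


Lemma continuous_sum_nat (R : realType) (m n : nat) (F : nat -> R -> R) :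
  (forall j, continuous (F j)) ->
  continuous (fun s => \sum_(m <= j < n) F j s).
Proof.
move=> Fcont; apply: continuous_big => [|j _]; first exact: add_continuous.
exact: Fcont.
Qed.

(** * Dual prices and reduced costs under single crossing *)

Section SingleCrossing.
Variables (R : realType) (c : nat -> R -> R) (t : nat -> R).

Definition cost_gap (j : nat) (s : R) : R :=
  c j.+1 s - c j s - (c j.+1 (t j.+1) - c j (t j.+1)).

(* [group_price] and [time_price] are dual variables for the mass and the
   capacity constraints, and [slack] is the reduced cost. *)
Definition group_price (k : nat) : R :=
  \sum_(0 <= j < k) (c j.+1 (t j.+1) - c j (t j.+1)).

Definition time_price (n : nat) (s : R) : R :=
  c 0 s + \sum_(0 <= j < n) Num.min (cost_gap j s) 0.

Definition slack (n k : nat) (s : R) : R :=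
  \sum_(0 <= j < k) Num.max (cost_gap j s) 0 -
  \sum_(k <= j < n) Num.min (cost_gap j s) 0.

(** The negative parts with index at least [k] cancel between [time_price] and [slack]. Below [k],
    negative and positive parts recombine into the gaps themselves, whose sum telescopes. *)
Lemma cost_slackE n k s : (k <= n)%N ->
  c k s = group_price k + time_price n s + slack n k s.
Proof.
move=> kn; rewrite /time_price (big_cat_nat (n := k))//= /slack.
set A := \sum_(0 <= j < k) Num.min _ _; set B := \sum_(0 <= j < k) Num.max _ _.
have AB : A + B = c k s - c 0 s - group_price k.
  rewrite -big_split/= -(telescope_sumr (fun j => c j s) (leq0n k)) -sumrB.
  by apply: eq_bigr => j _; rewrite addr_min_max addr0.
lra.
Qed.

Lemma slack_ge0 n k s : 0 <= slack n k s.
Proof.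
rewrite subr_ge0 (@le_trans _ _ 0)//.
  by rewrite sumr_le0// => j _; rewrite ge_min lexx orbT.
by rewrite sumr_ge0// => j _; rewrite le_max lexx orbT.
Qed.

Hypothesis c_cont : forall j, continuous (c j).

Lemma cost_gap_continuous j : continuous (cost_gap j).
Proof.
move=> s; apply: cvgB; last exact: cvg_cst.
by apply: cvgB; exact: c_cont.
Qed.

Lemma time_price_continuous n : continuous (time_price n).
Proof.
move=> s; apply: cvgD; first exact: c_cont.
apply: continuous_sum_nat => j r.
apply: (@continuous_min _ _ (cost_gap j) (cst 0)); last exact: cvg_cst.
exact: cost_gap_continuous.
Qed.

Lemma slack_continuous n k : continuous (slack n k).
Proof.
move=> s; apply: cvgB; apply: continuous_sum_nat => j r.
  apply: (@continuous_max _ _ (cost_gap j) (cst 0)); last exact: cvg_cst.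
  exact: cost_gap_continuous.
apply: (@continuous_min _ _ (cost_gap j) (cst 0)); last exact: cvg_cst.
exact: cost_gap_continuous.
Qed.

Variable n : nat.
Hypothesis c_cross : forall j, (j < n)%N ->
  {homo (fun s => c j.+1 s - c j s) : r s / r < s >-> s < r}.

Lemma cost_gap_gt0 j s : (j < n)%N -> s < t j.+1 -> 0 < cost_gap j s.
Proof. by move=> jn /(c_cross jn); rewrite subr_gt0. Qed.

Lemma cost_gap_lt0 j s : (j < n)%N -> t j.+1 < s -> cost_gap j s < 0.
Proof. by move=> jn /(c_cross jn); rewrite subr_lt0. Qed.

(** Only the last positive part, of index [k], is needed to be strict: its gap has not yet crossed
    zero. *)
Lemma slack_gt0_left k s : (k < n)%N -> s < t k.+1 -> 0 < slack n k.+1 s.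
Proof.
move=> kn sk; rewrite /slack big_nat_recr//=.
rewrite -addrA ltr_wpDl//.
  by rewrite sumr_ge0// => j _; rewrite le_max lexx orbT.
rewrite ltr_pwDl//; first by rewrite lt_max cost_gap_gt0.
by rewrite oppr_ge0 sumr_le0// => j _; rewrite ge_min lexx orbT.
Qed.

Lemma slack_gt0_right k s : (k < n)%N -> t k.+1 < s -> 0 < slack n k s.
Proof.
move=> kn ks; rewrite /slack ltr_wpDl//.
  by rewrite sumr_ge0// => j _; rewrite le_max lexx orbT.
rewrite oppr_gt0 big_ltn// -[ltRHS]addr0 ltr_leD//.
  by rewrite gt_min cost_gap_lt0.
by rewrite sumr_le0// => j _; rewrite ge_min lexx orbT.
Qed.

(** For [j >= k] the gap crosses zero at [t j.+1 >= t k.+1 >= s], so it has no negative part at [s];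
    for [j < k] it crosses at [t j.+1 <= t k <= s], so it has no positive part. *)
Lemma slack_eq0 k s :
  {homo t : i j / (i <= j)%N >-> i <= j} ->
  (k <= n)%N -> t k <= s <= t k.+1 -> slack n k s = 0.
Proof.
move=> t_le kn /andP[ks sk].
rewrite /slack !big1_seq ?subrr// => j /=;
  rewrite mem_index_iota => /andP[kj jn].
- have : t k.+1 <= t j.+1 by exact: t_le.
  move/(le_trans sk); rewrite le_eqVlt => /predU1P[->|/(cost_gap_gt0 jn)/ltW].
    by rewrite /cost_gap subrr minxx.
  by move=> /min_r.
- have jn' : (j < n)%N by exact: leq_trans jn kn.
  have : t j.+1 <= t k by exact: t_le.
  move/le_trans/(_ ks); rewrite le_eqVlt
    => /predU1P[<-|/(cost_gap_lt0 jn')/ltW].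
    by rewrite /cost_gap subrr maxxx.
  by move=> /max_r.
Qed.

End SingleCrossing.

Lemma lebesgue_aeS (R : realType) (P Q : R -> Prop) :
  (forall s, P s -> Q s) -> {ae lebesgue_measure, forall s, P s} ->
  {ae lebesgue_measure, forall s, Q s}.
Proof.
move=> PQ [N [mN N0 PN]]; exists N; split => // s /= nQs.
by apply: PN => /= /PQ.
Qed.

(** * Costs of feasible flows and complementary slackness *)

Section Feasible.
Variables (R : realType) (K : nat) (a b mu : R) (Q : 'I_K -> R).
Local Notation S := (`[a, b]%classic : set R).

(** The integral of [x k] is the real number [Q k], and a measurable function with finite integral
    is absolutely integrable. *)
Lemma feasible_integrable (x : 'I_K -> R -> R) (k : 'I_K) :
  feasible_flow S mu Q x -> lebesgue_measure.-integrable S (EFin \o x k).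
Proof.
move=> [xmeas _ _ xint]; apply/integrableP; split.
  apply/measurable_EFinP; exact: xmeas.
by rewrite integral_fin_num_abs ?xint//; exact: xmeas.
Qed.

Lemma feasible_costE (c w x : 'I_K -> R -> R) (p : 'I_K -> R) (m : R -> R) :
  continuous m -> (forall k, continuous (w k)) ->
  (forall k s, c k s = p k + m s + w k s) ->
  feasible_flow S mu Q x ->
  total_schedule_cost S c x =
  ((\sum_(k < K) p k * Q k)%:E + \int[lebesgue_measure]_(s in S) (m s * mu)%:E
   + total_schedule_cost S w x)%E.
Proof.
move=> mcont wcont cE xfeas.
have [xmeas _ xmu xint] := xfeas.
have int_x k := @feasible_integrable x k xfeas.
have int_px k : lebesgue_measure.-integrable S (EFin \o (fun s => p k * x k s)).
  by apply: integrable_continuousM => // ?; exact: cvg_cst.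
have int_mx k : lebesgue_measure.-integrable S (EFin \o (fun s => m s * x k s)).
  exact: integrable_continuousM.
have int_wx k :
    lebesgue_measure.-integrable S (EFin \o (fun s => w k s * x k s)).
  exact: integrable_continuousM.
have int_pmx k : lebesgue_measure.-integrable S
    (EFin \o (fun s => p k * x k s + m s * x k s)).
  by apply: (integrableD _ (int_px k) (int_mx k)).
(* The capacity constraint, valid almost everywhere, distributes the [m]-part over the groups so
   that costs can be compared group by group. *)
have -> : (\int[lebesgue_measure]_(s in S) (m s * mu)%:E =
    \sum_(k < K) \int[lebesgue_measure]_(s in S) (m s * x k s)%:E)%E.
  rewrite -(integral_sum _ int_mx)//=.
  apply: ae_eq_integral => //.
  - apply/measurable_EFinP; apply: measurable_funM => //.
    by apply: measurable_funTS; exact: continuous_measurable_fun.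
  - by apply: emeasurable_sum => k; exact: measurable_int _ (int_mx k).
  - apply: lebesgue_aeS xmu => s xs Ss.
    by rewrite sumEFin -mulr_sumr (xs Ss).
rewrite /total_schedule_cost -sumEFin -!big_split/=; apply: eq_bigr => k _.
transitivity (\int[lebesgue_measure]_(s in S)
    ((EFin \o (fun s => p k * x k s + m s * x k s)%R) s +
     (EFin \o (fun s => w k s * x k s)%R) s))%E.
  by apply: eq_integral => s _ /=; rewrite -EFinD cE !mulrDl.
rewrite integralD_EFin//; congr (_ + _)%E.
transitivity (\int[lebesgue_measure]_(s in S)
    ((EFin \o (fun s => p k * x k s)%R) s +
     (EFin \o (fun s => m s * x k s)%R) s))%E.
  by [].
rewrite integralD_EFin//; congr (_ + _)%E.
under eq_integral do rewrite /= EFinM.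
by rewrite integralZl//; [rewrite xint -EFinM|exact: int_x].
Qed.

(** The flow [y] certifies that a zero [w]-cost is attainable. Optimality then bounds the [w]-cost
    of [x] by 0, and as a sum of nonnegative integrals it vanishes term by term. *)
Lemma complementary_slackness (c w x y : 'I_K -> R -> R) (p : 'I_K -> R)
    (m : R -> R) :
  continuous m -> (forall k, continuous (w k)) ->
  (forall k s, c k s = p k + m s + w k s) ->
  (forall k s, 0 <= w k s) ->
  equilibrium_flow S mu Q c x ->
  feasible_flow S mu Q y -> (forall k s, S s -> w k s * y k s = 0) ->
  forall k, {ae lebesgue_measure, forall s, S s -> w k s * x k s = 0}.
Proof.
move=> mcont wcont cE w0 [xfeas xopt] yfeas wy0 k.
have int_wx i :
    lebesgue_measure.-integrable S (EFin \o (fun s => w i s * x i s)).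
  apply: integrable_continuousM; [exact: wcont|exact: feasible_integrable].
have wxE i : (\int[lebesgue_measure]_(s in S) (w i s * x i s)%:E =
    \int[lebesgue_measure]_(s in S) `|(w i s * x i s)%:E|)%E.
  apply: ae_eq_integral => //.
  - exact: measurable_int _ (int_wx i).
  - by apply: measurableT_comp => //; exact: measurable_int _ (int_wx i).
  - have [_ /(_ i) + _ _] := xfeas.
    by apply: lebesgue_aeS => s x0 Ss; rewrite gee0_abs// lee_fin mulr_ge0// x0.
have wx_ge0 i : (0 <= \int[lebesgue_measure]_(s in S) (w i s * x i s)%:E)%E.
  by rewrite wxE integral_ge0.
have wx_le0 : (total_schedule_cost S w x <= 0)%E.
  (* Finiteness is what allows the common part of both costs to be cancelled in the extended
     reals. *)
  have mfin : (\int[lebesgue_measure]_(s in S) (m s * mu)%:E)%E \is a fin_num.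
    apply: integrable_fin_num => //.
    apply: (@integrable_continuousM _ _ _ m (cst mu)) => //.
    apply: continuous_compact_integrable; first exact: segment_compact.
    by apply: continuous_subspaceT => ?; exact: cvg_cst.
  have := xopt _ yfeas.
  rewrite (feasible_costE mcont wcont cE xfeas).
  rewrite (feasible_costE mcont wcont cE yfeas).
  rewrite leeD2lE; last by rewrite fin_numD mfin.
  move=> /le_trans; apply.
  rewrite /total_schedule_cost big1// => i _.
  by apply: integral0_eq => s Ss; rewrite wy0.
have wx0 : (\int[lebesgue_measure]_(s in S) (w k s * x k s)%:E = 0)%E.
  apply/eqP; rewrite eq_le wx_ge0 andbT (le_trans _ wx_le0)//.
  rewrite /total_schedule_cost (bigD1 k)//= leeDl//.
  by apply: sume_ge0 => i _; exact: wx_ge0.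
have : ae_eq lebesgue_measure S (EFin \o (fun s => w k s * x k s)) (cst 0%E).
  apply/ae_eq_integral_abs => //; first exact: measurable_int _ (int_wx k).
  by rewrite -[RHS]wx0 wxE.
by apply: lebesgue_aeS => s h /h [].
Qed.

End Feasible.

(** * Switching times and the sorted flow *)

Section SortingTime.
Variables (R : realType) (K : nat) (mu : R) (Q : 'I_K -> R) (s0 : R).
Local Notation t := (sorting_time mu Q s0).

Lemma sorting_time0 : t 0 = s0.
Proof. by rewrite /sorting_time big_pred0 ?addr0. Qed.

Lemma sorting_timeS (k : 'I_K) : t k.+1 = t k + Q k / mu.
Proof.
rewrite /sorting_time (bigD1 k)//= -addrA; congr (_ + _).
rewrite addrC; congr (_ + _).
by apply: eq_bigl => i; rewrite ltnS ltn_neqAle andbC.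
Qed.

Lemma sorting_time_max : t K = s0 + rush_length mu Q.
Proof.
rewrite /sorting_time /rush_length mulr_suml; congr (_ + _).
by apply: eq_bigl => i; rewrite ltn_ord.
Qed.

Hypotheses (mu_gt0 : 0 < mu) (Q_gt0 : forall k, 0 < Q k).

Lemma sorting_time_ltS j : (j < K)%N -> t j < t j.+1.
Proof.
move=> jK; have := sorting_timeS (Ordinal jK) => /= ->.
by rewrite ltrDl divr_gt0.
Qed.

(** Indices beyond [K] are included, where [t] is constant; hence a comparison of sums instead of an
    iteration of the strict step. *)
Lemma sorting_time_le : {homo t : i j / (i <= j)%N >-> i <= j}.
Proof.
move=> i j ij; rewrite lerD2l [leRHS]big_mkcond [leLHS]big_mkcond.
rewrite ler_sum//= => k _.
case: ifPn => ki; first by rewrite (leq_trans ki ij).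
by case: ifPn => // _; rewrite divr_ge0// ltW.
Qed.

(** Half-open intervals make the groups disjoint, so capacity is met exactly at the interior
    switching times; it fails only at [t K]. *)
Definition sorted_flow (k : 'I_K) (s : R) : R :=
  mu * \1_`[t k, t k.+1[ s.

(** Each indicator is the difference of the truth values of [s < t k.+1] and [s < t k], so the sum
    telescopes. *)
Lemma sorted_flow_sum s : s0 <= s < t K -> \sum_(k < K) sorted_flow k s = mu.
Proof.
move=> /andP[s0s stK].
have indE (k : 'I_K) : sorted_flow k s =
    mu * ((s < t k.+1)%R%:R - (s < t k)%R%:R).
  rewrite /sorted_flow indicE mem_setE in_itv/=; congr (_ * _).
  have tk := ltW (sorting_time_ltS (ltn_ord k)).
  rewrite leNgt; have [sk|_] /= := boolP (s < t k); last by rewrite subr0.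
  by rewrite (lt_le_trans sk tk) subrr.
under eq_bigr do rewrite indE.
rewrite -mulr_sumr -(big_mkord xpredT
  (fun k => (s < t k.+1)%R%:R - (s < t k)%R%:R)).
rewrite (telescope_sumr (fun k => (s < t k)%R%:R))//.
by rewrite sorting_time0 stK ltNge s0s subr0 mulr1.
Qed.

Lemma sorted_flow_feasible :
  feasible_flow (rush_period mu Q s0) mu Q sorted_flow.
Proof.
have mS : measurable (rush_period mu Q s0) by exact: measurable_itv.
have mflow k : measurable_fun (rush_period mu Q s0) (sorted_flow k).
  by apply: measurable_funM.
split => //.
- by move=> k; apply: aeW => s _; rewrite mulr_ge0// ltW.
(* The end of the rush period, where every sorted flow is 0, is the exceptional null set. *)
- exists [set t K]; split => //; first exact: lebesgue_measure_set1.
  move=> s /= /not_implyP[]; rewrite /rush_period/= in_itv/= => /andP[s0s sT].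
  move=> sum_neq; apply/eqP; apply: contra_notT sum_neq => stK.
  apply: sorted_flow_sum.
  by rewrite s0s lt_neqAle stK sorting_time_max.
- move=> k; rewrite /sorted_flow.
  have tk := sorting_time_ltS (ltn_ord k).
  have len : lebesgue_measure (`[t k, t k.+1[ : set R) = (Q k / mu)%:E.
    rewrite lebesgue_measure_itv/= lte_fin tk -EFinB sorting_timeS.
    by rewrite addrAC subrr add0r.
  have sub : `[t k, t k.+1[ `<=` rush_period mu Q s0.
    move=> s /=; rewrite /rush_period/= !in_itv/= -sorting_time_max.
    move=> /andP[ks sk]; apply/andP; split.
      by apply: le_trans ks; rewrite -[leLHS]sorting_time0 sorting_time_le.
    by apply: (le_trans (ltW sk)); exact: sorting_time_le.
  under eq_integral do rewrite EFinM.
  rewrite ge0_integralZl//; last 2 first.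
  + by apply/measurable_EFinP; exact: measurable_funTS.
  + by rewrite lee_fin ltW.
  rewrite integral_indic// setIidl//.
  transitivity (mu%:E * (Q k / mu)%:E)%E; first by congr (_ * _)%E.
  by rewrite -EFinM mulrC divfK// gt_eqF.
Qed.

End SortingTime.

(** * Sorting property of the equilibrium flow *)

Theorem proposition5p2 (R : realType) (K : nat) (hK : (0 < K)%N)
  (sigma : 'I_K -> R)
  (hsigma : forall i j : 'I_K, (i < j)%N -> sigma i < sigma j)
  (f : R -> R) (hfcont : continuous f) (hfconv : strictly_convex f)
  (hfmin : forall x : R, f 0 <= f x)
  (mu : R) (hmu : 0 < mu)
  (Q : 'I_K -> R) (hQ : forall k : 'I_K, 0 < Q k)
  (s0 : R) (x : 'I_K -> R -> R)
  (hx : equilibrium_flow (rush_period mu Q s0) mu Q (schedule_cost f sigma) x) :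
  (forall k : 'I_K,
     sorting_time mu Q s0 k.+1 - sorting_time mu Q s0 k = Q k / mu /\
     {ae lebesgue_measure, forall s : R,
        (rush_period mu Q s0 `\`
           `[sorting_time mu Q s0 k, sorting_time mu Q s0 k.+1]) s ->
        x k s = 0}) /\
  [/\ sorting_time mu Q s0 0 = s0,
      forall j : nat, (j < K)%N ->
        sorting_time mu Q s0 j < sorting_time mu Q s0 j.+1
    & sorting_time mu Q s0 K = s0 + rush_length mu Q].
Proof.
split; last first.
  split; [exact: sorting_time0 | by move=> j; exact: sorting_time_ltS |
          exact: sorting_time_max].
move=> k; split; first by rewrite sorting_timeS addrAC subrr add0r.
case: K hK sigma hsigma Q hQ x hx k => [//|n] _ sigma hsigma Q hQ x hx k.
pose t := sorting_time mu Q s0.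
have t_le : {homo t : i j / (i <= j)%N >-> i <= j} by exact: sorting_time_le.
(* Costs are extended to all natural indices; past [n], [inord] falls back to group 0, which keeps
   continuity, while crossing is claimed only for [j < n]. *)
pose c j := schedule_cost f sigma (inord j : 'I_n.+1).
have c_cont j : continuous (c j).
  move=> s; apply: (@continuous_comp _ _ _ (fun s => s - sigma (inord j)) f).
    by apply: cvgB; [exact: cvg_id|exact: cvg_cst].
  exact: hfcont.
have c_cross j : (j < n)%N ->
    {homo (fun s => c j.+1 s - c j s) : r s / r < s >-> s < r}.
  move=> jn r s rs; apply: strictly_convex_increment => //.
  by apply: hsigma; rewrite !inordK// ltnS// ltnW.
have kn : (k <= n)%N by rewrite -ltnS.
have slack_flow (i : 'I_n.+1) s :
    rush_period mu Q s0 s -> slack c t n i s * sorted_flow mu Q s0 i s = 0.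
  move=> _; rewrite /sorted_flow indicE mem_setE in_itv/=.
  have [/andP[is_ si]|_] := boolP (_ && _); last by rewrite mulr0 mulr0.
  rewrite (slack_eq0 c_cross t_le) ?mul0r//; first by rewrite -ltnS.
  by rewrite is_ ltW.
have cE (i : 'I_n.+1) s : schedule_cost f sigma i s =
    group_price c t i + time_price c t n s + slack c t n i s.
  rewrite -cost_slackE; first by rewrite /c inord_val.
  by rewrite -ltnS.
have := @complementary_slackness R n.+1 s0 (s0 + rush_length mu Q) mu Q
  (schedule_cost f sigma) (fun i => slack c t n i) x (sorted_flow mu Q s0)
  (fun i => group_price c t i) (time_price c t n)
  (@time_price_continuous _ _ _ c_cont n)
  (fun i => @slack_continuous _ _ _ c_cont n i)
  cE (fun i s => slack_ge0 c t n i s) hx (sorted_flow_feasible s0 hmu hQ)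
  slack_flow k.
apply: lebesgue_aeS => s wx0 [Ss /negP ns].
apply/eqP; move/eqP: (wx0 Ss); rewrite mulf_eq0 => /orP[|//].
(* It remains to see that the slack is positive outside the interval of group [k]. *)
rewrite gt_eqF//.
move: Ss ns; rewrite /rush_period/= !in_itv/= => /andP[s0s sT].
rewrite negb_and -!ltNge => /orP[sk|ks].
(* No time of the rush period precedes the interval of the first group. *)
- case: (posnP k) => [k0|k0].
    by move: sk; rewrite k0 sorting_time0 ltNge s0s.
  by rewrite -(prednK k0); apply: slack_gt0_left; rewrite // prednK.
(* Likewise [k = n] is excluded, since the interval of the last group ends with the rush period. *)
- apply: slack_gt0_right => //; rewrite ltn_neqAle kn andbT.
  by apply: contraTneq ks => ->; rewrite sorting_time_max -leNgt.
Qed.
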